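(* Let $\mathcal{H}$ be a real Hilbert space and $f,g\in\Gamma_0(\mathcal{H})$ such that $\inf_{x\in\mathcal{H}}\big(f(x)+g(x)\big)=\sup_{\nu\in\mathcal{H}}\big(-f^*(\nu)-g^*(-\nu)\big)$. Define $F(x,\nu)=f(x)+f^*(\nu)$, $G(x,\nu)=g(x)+g^*(-\nu)$ and the nonempty closed convex cones $$\mathcal{F}=\{(x,\nu,\tau,\kappa)\in\mathcal{H}\times\mathcal{H}\times\mathbb{R}^2\mid\widetilde{F}(x,\nu,\tau)\le-\kappa\},\qquad \mathcal{G}=\{(x,\nu,\tau,\kappa)\in\mathcal{H}\times\mathcal{H}\times\mathbb{R}^2\mid\widetilde{G}(x,\nu,\tau)\le\kappa\}.$$ Consider the Douglas–Rachford iteration, for $k=1,2,\dots$, \begin{align*} (x^k,\nu^k,\tau^k,\kappa^k)&=P_{\mathcal{F}}(s_x^k,s_\nu^k,s_\tau^k,s_\kappa^k),\\ (\tilde x^k,\tilde\nu^k,\tilde\tau^k,\tilde\kappa^k)&=P_{\mathcal{G}}\big(2(x^k,\nu^k,\tau^k,\kappa^k)-(s_x^k,s_\nu^k,s_\tau^k,s_\kappa^k)\big),\\ (s_x^{k+1},s_\nu^{k+1},s_\tau^{k+1},s_\kappa^{k+1})&=(s_x^k,s_\nu^k,s_\tau^k,s_\kappa^k)+(\tilde x^k,\tilde\nu^k,\tilde\tau^k,\tilde\kappa^k)-(x^k,\nu^k,\tau^k,\kappa^k). \end{align*} Suppose the initial point satisfies $s_x^1=s_\nu^1=p^1$ and $s_\tau^1=s_\kappa^1=r^1$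 for some $p^1\in\mathcal{H}$, $r^1\in\mathbb{R}$. Then for every $k\ge1$ one has $s_x^k=s_\nu^k=:p^k$ and $s_\tau^k=s_\kappa^k=:r^k$, and with $\tilde p^k:=2x^k-p^k$ and $\tilde r^k:=2\tau^k-r^k$, \begin{align*} &(x^k,\nu^k,\tau^k,\kappa^k)=P_{\mathcal{F}}(p^k,p^k,r^k,r^k),\qquad \nu^k=p^k-x^k,\quad \kappa^k=r^k-\tau^k,\\ &(\tilde x^k,\tilde\nu^k,\tilde\tau^k,\tilde\kappa^k)=P_{\mathcal{G}}(\tilde p^k,-\tilde p^k,\tilde r^k,-\tilde r^k),\qquad \tilde\nu^k=\tilde x^k-\tilde p^k,\quad \tilde\kappa^k=\tilde\tau^k-\tilde r^k,\\ &(p^{k+1},r^{k+1})=(p^k,r^k)+(\tilde x^k,\tilde\tau^k)-(x^k,\tau^k), \end{align*} together with $\langle x^k\mid p^k-x^k\rangle+\tau^k(r^k-\tau^k)=0$ and $\langle\tilde x^k\mid\tilde p^k-\tilde x^k\rangle+\tilde\tau^k(\tilde r^k-\tilde\tau^k)=0$.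
   Context: $\Gamma_0(\mathcal{H})$ is the set of proper lower semicontinuous convex functions $\mathcal{H}\to\left]-\infty,+\infty\right]$. For $h\in\Gamma_0(\mathcal{H})$: $h^*(u)=\sup_{x}(\langle x\mid u\rangle-h(x))$; $(\operatorname{rec}h)(y)=\sup_{x\in\operatorname{dom}h}(h(x+y)-h(x))$; and the perspective function is $\widetilde{h}(x,\tau)=\tau h(x/\tau)$ if $\tau>0$, $(\operatorname{rec}h)(x)$ if $\tau=0$, $+\infty$ if $\tau<0$. For $F,G\in\Gamma_0(\mathcal{H}\times\mathcal{H})$ the perspectives are functions of $((x,\nu),\tau)$, written $(x,\nu,\tau)$. Product spaces carry the sum inner product, and $P_C$ denotes the metric projection onto a nonempty closed convex set $C$. *)

(* Defs.v *)
From HB Require Import structures.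
From mathcomp Require Import all_boot all_order all_algebra sesquilinear.
From mathcomp Require Import all_classical all_reals all_analysis.

Set Implicit Arguments.
Unset Strict Implicit.
Unset Printing Implicit Defensive.
Import Order.TTheory GRing.Theory Num.Theory numFieldNormedType.Exports.
Local Open Scope classical_set_scope.
Local Open Scope ring_scope.

(* A real Hilbert space is rendered as a complete normed module H over
   R : realType together with a dot product ip : {dot H for idfun} such that
   induces_norm ip; H is then complete for the norm of ip. *)
Definition induces_norm (R : realType) (H : normedModType R)
  (ip : H -> H -> R) : Prop := forall x : H, ip x x = `|x| ^+ 2.

Section ConvexFunctions.
Context {R : realType}.
Local Open Scope ereal_scope.

Definition dom (T : Type) (h : T -> \bar R) : set T := [set x | h x < +oo].

Definition proper (T : Type) (h : T -> \bar R) : Prop :=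
  (forall x, -oo < h x) /\ dom h !=set0.

(* The library's convex_function is restricted to real-valued functions. The
   right-hand side is not of the form oo - oo as soon as -oo < h. *)
Definition econvex (V : lmodType R) (h : V -> \bar R) : Prop :=
  forall (x y : V) (t : R), (0 < t < 1)%R ->
    h (t *: x + (1 - t) *: y)%R <= t%:E * h x + (1 - t)%:E * h y.

Definition Gamma0 (V : normedModType R) (h : V -> \bar R) : Prop :=
  [/\ proper h, lower_semicontinuous h & econvex h].

Definition conjugate (V : Type) (ip : V -> V -> R) (h : V -> \bar R) (u : V) :
    \bar R :=
  ereal_sup [set (ip x u)%:E - h x | x in [set: V]].

Definition recession (V : lmodType R) (h : V -> \bar R) (y : V) : \bar R :=
  ereal_sup [set h (x + y)%R - h x | x in dom h].

Definition perspective (V : lmodType R) (h : V -> \bar R) (z : V * R) :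
    \bar R :=
  if (0 < z.2)%R then z.2%:E * h (z.2^-1 *: z.1)%R
  else if (z.2 == 0)%R then recession h z.1
  else +oo.

End ConvexFunctions.

Section Projections.
Context {R : realType}.

(* The library's norm on a product is the maximum norm, which gives the right
   topology but not the Hilbert norm; metric projections on products are
   therefore taken with respect to an explicit inner product. *)
Definition sum_ip (U V : Type) (ipU : U -> U -> R) (ipV : V -> V -> R)
  (z w : U * V) : R := ipU z.1 w.1 + ipV z.2 w.2.

Definition ip_norm (V : Type) (ip : V -> V -> R) (x : V) : R :=
  Num.sqrt (ip x x).

Definition is_projection (V : zmodType) (ip : V -> V -> R) (C : set V)
  (x p : V) : Prop :=
  C p /\ forall q, C q -> ip_norm ip (x - p) <= ip_norm ip (x - q).

(* The default value 0 is returned only if x has no nearest point in C. *)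
Definition projection (V : zmodType) (ip : V -> V -> R) (C : set V) (x : V) :
  V := xget 0 [set p | is_projection ip C x p].

Definition is_cone (V : lmodType R) (C : set V) : Prop :=
  forall (t : R) (x : V), 0 < t -> C x -> C (t *: x).

Definition ip4 (H : Type) (ip : H -> H -> R) :
    (H * H * R * R) -> (H * H * R * R) -> R :=
  sum_ip (sum_ip (sum_ip ip ip) *%R) *%R.

End Projections.

(* Main.v *)
Require Import Defs.
From HB Require Import structures.
From mathcomp Require Import all_boot all_order all_algebra sesquilinear.
From mathcomp Require Import all_classical all_reals all_analysis ring lra.

Set Implicit Arguments.
Unset Strict Implicit.
Unset Printing Implicit Defensive.
Import Order.TTheory GRing.Theory Num.Theory numFieldNormedType.Exports.
Local Open Scope classical_set_scope.
Local Open Scope ring_scope.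

(** Put L(x,nu,tau,kappa) = (nu,x,kappa,tau).  Since F(x,nu) = f(x) + f^*(nu)
satisfies F^*(nu,x) = F(x,nu) (Fenchel-Moreau), the polar of the cone of F is
the image of this cone under the isometry L.  A point s = (p,p,r,r) is fixed by
L, so its Moreau decomposition is s = P(s) + L P(s) with P(s) orthogonal to
L P(s); this gives nu = p - x, kappa = r - tau and the orthogonality relation.
The cone of G is carried to a cone of the first kind, with g in place of f, by
the isometry (x,nu,tau,kappa) |-> (x,-nu,tau,-kappa), and the symmetry of s is
then propagated by induction on k. *)

(** * Inner products dominating the norm, and metric projections *)

(* Unlike an inner product inducing the norm, this notion is stable under
   products, which carry the maximum norm. *)
Record hilbertian (R : realType) (V : normedModType R) (ip : V -> V -> R) :
    Prop := Hilbertian {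
  ip_sym : forall x y, ip x y = ip y x;
  ipDl : forall x y z, ip (x + y) z = ip x z + ip y z;
  ipZl : forall t x y, ip (t *: x) y = t * ip x y;
  ip_ge_norm : forall x, `|x| ^+ 2 <= ip x x;
  ip_continuous : continuous (fun x => ip x x);
  hilbertian_complete :
    forall F : set_system V, ProperFilter F -> cauchy F -> cvg F }.

Section HilbertianTheory.
Context {R : realType} {V : normedModType R} {ip : V -> V -> R}.
Hypothesis hip : hilbertian ip.
Implicit Types (x y z : V) (C : set V) (t : R).

Lemma ipDr x y z : ip x (y + z) = ip x y + ip x z.
Proof. by rewrite ip_sym// ipDl// !(ip_sym hip x). Qed.

Lemma ipZr t x y : ip x (t *: y) = t * ip x y.
Proof. by rewrite ip_sym// ipZl// (ip_sym hip x). Qed.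

Lemma ipNl x y : ip (- x) y = - ip x y.
Proof. by rewrite -scaleN1r ipZl// mulN1r. Qed.

Lemma ipNr x y : ip x (- y) = - ip x y.
Proof. by rewrite -scaleN1r ipZr mulN1r. Qed.

Definition ipE := (ipDr, ipZr, ipNl, ipNr, ipDl hip, ipZl hip).

Lemma ip_ge0 x : 0 <= ip x x.
Proof. exact: le_trans (sqr_ge0 _) (ip_ge_norm hip x). Qed.

Lemma ip_eq0 x : ip x x <= 0 -> x = 0.
Proof.
move=> x0; apply/eqP; rewrite -normr_eq0 -sqrf_eq0 eq_le sqr_ge0 andbT.
exact: le_trans (ip_ge_norm hip x) x0.
Qed.

Lemma ip_norm_le x y : (ip_norm ip x <= ip_norm ip y) = (ip x x <= ip y y).
Proof. by rewrite /ip_norm ler_sqrt// ip_ge0. Qed.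

(** Polarization reduces this to the continuity of the quadratic form. *)
Lemma continuous_ipl y : continuous (ip^~ y).
Proof.
have -> : ip^~ y = fun x => 4^-1 * (ip (x + y) (x + y) - ip (x - y) (x - y)).
  by apply/funext => x; rewrite !ipE !(ip_sym hip y x); field.
move=> x; apply: cvgM; first exact: cvg_cst.
apply: cvgB.
  apply: (@continuous_comp _ _ _ (fun x => x + y) (fun x => ip x x)).
    by apply: cvgD; [exact: cvg_id|exact: cvg_cst].
  exact: ip_continuous.
apply: (@continuous_comp _ _ _ (fun x => x - y) (fun x => ip x x)).
  by apply: cvgB; [exact: cvg_id|exact: cvg_cst].
exact: ip_continuous.
Qed.

Lemma ip_subZ t x y :
  ip (x - t *: y) (x - t *: y) = ip x x - 2 * t * ip x y + t * (t * ip y y).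
Proof. by rewrite !ipE (ip_sym hip y x); ring. Qed.

Definition segment_closed C := forall x y t, 0 <= t <= 1 -> C x -> C y ->
  C (t *: x + (1 - t) *: y).

Lemma projection_variational C x p q : segment_closed C ->
  is_projection ip C x p -> C q -> ip (x - p) (q - p) <= 0.
Proof.
move=> cC [Cp minp] Cq; rewrite leNgt; apply/negP => B_gt0.
have D_ge0 := ip_ge0 (q - p).
set B := ip _ _ in B_gt0; set D := ip _ _ in D_ge0.
have BD_gt0 : 0 < B + D by lra.
(* On the segment from [p] to [q] the squared distance to [x] changes by [- 2 * t * B + t ^+ 2 * D].
   The extra [B] in the denominator keeps [t] at most 1, even if [D] vanishes, and the change is
   still negative. *)
pose t := B / (B + D).
have tBD : t * (B + D) = B by rewrite /t divfK// gt_eqF.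
have t_gt0 : 0 < t by rewrite divr_gt0.
have t_le1 : t <= 1 by rewrite /t ler_pdivrMr// mul1r; lra.
have t01 : 0 <= t <= 1 by rewrite (ltW t_gt0).
have := minp _ (cC _ _ _ t01 Cq Cp); rewrite ip_norm_le.
have -> : x - (t *: q + (1 - t) *: p) = (x - p) - t *: (q - p).
  rewrite scalerBl scale1r scalerBr !opprD !opprK -!addrA.
  by congr (_ + _); exact: addrCA.
rewrite ip_subZ -/B -/D; nra.
Qed.

(** A minimizing sequence is Cauchy, and its limit attains the infimum [d] of the squared
    distances. *)
Lemma projection_exists C x : C !=set0 -> closed C -> segment_closed C ->
  exists p, is_projection ip C x p.
Proof.
move=> C0 clC cC; pose q z := ip (x - z) (x - z).
pose E := q @` C; pose d := inf E.
have infE : has_inf E.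
  split; first by case: C0 => c Cc; exists (q c), c.
  by exists 0 => _ [c _ <-]; exact: ip_ge0.
have d_le c : C c -> d <= q c.
  by move=> Cc; apply: ge_inf; [case: infE|exists c].
have approx n : {c | C c /\ q c < d + n.+1%:R^-1}.
  apply: cid; have [|_ [c Cc <-] ?] := @inf_adherent _ E n.+1%:R^-1 _ infE.
    by rewrite invr_gt0.
  by exists c.
pose u n := sval (approx n).
have Cu n : C (u n) by rewrite /u; case: (approx n) => /= ? [].
have qu n : q (u n) < d + n.+1%:R^-1 by rewrite /u; case: (approx n) => /= ? [].
(* Parallelogram identity: the midpoint of [u m] and [u n] lies in [C], so its squared distance to
   [x] is at least [d]. *)
have dist m n : `|u m - u n| ^+ 2 <= 2 * (m.+1%:R^-1 + n.+1%:R^-1).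
  apply: le_trans (ip_ge_norm hip _) _.
  have h01 : 0 <= (2^-1 : R) <= 1 by lra.
  have := d_le _ (cC _ _ _ h01 (Cu m) (Cu n)).
  rewrite /q.
  have -> : x - (2^-1 *: u m + (1 - 2^-1) *: u n) =
            2^-1 *: ((x - u m) + (x - u n)).
    rewrite (_ : 1 - 2^-1 = 2^-1 :> R); last by field.
    rewrite !scalerDr !scalerN opprD addrACA -scalerDl.
    by rewrite (_ : 2^-1 + 2^-1 = 1 :> R) ?scale1r//; field.
  have -> : u m - u n = (x - u n) - (x - u m).
    by rewrite opprB [x - u n]addrC addrACA subrr addr0 addrC.
  have := qu m; have := qu n; rewrite /q.
  move: (x - u m) (x - u n) m.+1%:R^-1 n.+1%:R^-1 => a b i j.
  rewrite !ipE (ip_sym hip b a); lra.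
have /(hilbertian_complete hip _) : cauchy (u @ \oo).
  apply/cauchy_ballP => /= e e0.
  have e4 : 0 < e ^+ 2 / 4 by rewrite divr_gt0// exprn_gt0.
  have [N _ HN] := near_infty_natSinv_lt (PosNum e4).
  exists (u @` [set n | (N <= n)%N], u @` [set n | (N <= n)%N]) => /=.
    by split; exists N => // n Nn; exists n.
  move=> [_ _] /= [[m Nm <-] [n Nn <-]].
  rewrite -ball_normE /= -ltr_sqr ?nnegrE// ?(ltW e0)//.
  apply: le_lt_trans (dist m n) _.
  have := HN m Nm; have := HN n Nn => /=.
  move: m.+1%:R^-1 n.+1%:R^-1 => i j; lra.
move=> /cvg_ex[p up].
exists p; split.
  by apply: (closed_cvg _ clC _ _ up); near=> n; exact: Cu.
move=> c Cc; rewrite ip_norm_le; apply: le_trans (d_le _ Cc).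
have qcvg : q (u n) @[n --> \oo] --> q p.
  apply: continuous_cvg up.
  apply: (@continuous_comp _ _ _ (fun z => x - z) (fun z => ip z z)).
    by apply: cvgB; [exact: cvg_cst|exact: cvg_id].
  exact: ip_continuous.
apply/ler_addgt0Pr => e e0.
apply: (closed_cvg _ (@closed_le _ (d + e)) _ _ qcvg).
near=> n => /=; apply: (le_trans (ltW (qu n))); rewrite lerD2l ltW//.
by near: n; exact: (near_infty_natSinv_lt (PosNum e0)).
Unshelve. all: by end_near. Qed.

Lemma projectionP C x : C !=set0 -> closed C -> segment_closed C ->
  is_projection ip C x (projection ip C x).
Proof. by move=> C0 clC cC; apply: xgetPex; exact: projection_exists. Qed.

End HilbertianTheory.

(** * The base space, the real line and products *)

Lemma hilbertian_dot (R : realType) (H : completeNormedModType R)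
  (ip : {dot H for idfun}) : induces_norm ip -> hilbertian (V := H) ip.
Proof.
move=> ipn; split.
- by move=> x y; rewrite hermC /= expr0 mul1r.
- by move=> x y z; rewrite linearDl.
- by move=> t x y; rewrite linearZl_LR.
- by move=> x; rewrite ipn.
- move=> x; under eq_fun do rewrite ipn expr2.
  by apply: cvgM; exact: norm_continuous.
- by move=> F FF; exact: cauchy_cvg.
Qed.

Lemma hilbertian_mul (R : realType) : hilbertian (V := R) *%R.
Proof.
split.
- exact: mulrC.
- exact: mulrDl.
- by move=> t x y; rewrite /= -mulrA.
- by move=> x; rewrite -normrX ger0_norm ?sqr_ge0// expr2.
- by move=> x; apply: cvgM; exact: cvg_id.
- by move=> F FF; exact: cauchy_cvg.
Qed.

(** The square of a maximum is at most the sum of the squares. A Cauchy filter on the product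
    converges because both of its coordinate images do. *)
Lemma hilbertian_sum (R : realType) (U V : normedModType R)
  (ipU : U -> U -> R) (ipV : V -> V -> R) :
  hilbertian ipU -> hilbertian ipV ->
  hilbertian (V := (U * V)%type) (sum_ip ipU ipV).
Proof.
move=> hU hV; rewrite /sum_ip; split.
- by move=> x y; rewrite (ip_sym hU) (ip_sym hV).
- by move=> x y z; rewrite /= (ipDl hU) (ipDl hV) addrACA.
- by move=> t x y; rewrite /= (ipZl hU) (ipZl hV) mulrDr.
- move=> x; have := ip_ge_norm hU x.1; have := ip_ge_norm hV x.2.
  have := sqr_ge0 `|x.1|; have := sqr_ge0 `|x.2|.
  have -> : `|x| = Num.max `|x.1| `|x.2| by [].
  rewrite /=; move: `|x.1| `|x.2| (ipU _ _) (ipV _ _) => a b c e.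
  by rewrite maxEle; case: ifP => _; lra.
- move=> x; apply: cvgD.
    apply: (continuous_comp (g := fun z => ipU z z)); first exact: cvg_fst.
    exact: ip_continuous.
  apply: (continuous_comp (g := fun z => ipV z z)); first exact: cvg_snd.
  exact: ip_continuous.
- move=> F FF /cauchy_ballP cF.
  have c1 : cauchy (fst @ F).
    apply/cauchy_ballP => e e0; have [[A B] /= [FA FB] AB] := cF e e0.
    exists (fst @` A, fst @` B).
      by split; [apply: filterS FA|apply: filterS FB] => z Az /=; exists z.
    by move=> [_ _] /= [[a Aa <-] [b Bb <-]]; have [] := AB (a, b) (conj Aa Bb).
  have c2 : cauchy (snd @ F).
    apply/cauchy_ballP => e e0; have [[A B] /= [FA FB] AB] := cF e e0.
    exists (snd @` A, snd @` B).
      by split; [apply: filterS FA|apply: filterS FB] => z Az /=; exists z.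
    by move=> [_ _] /= [[a Aa <-] [b Bb <-]]; have [] := AB (a, b) (conj Aa Bb).
  have [a Fa] : exists a : U, fst @ F --> a.
    apply/(@cvg_ex U).
    exact: (hilbertian_complete hU (fmap_proper_filter _ FF) c1).
  have [b Fb] : exists b : V, snd @ F --> b.
    apply/(@cvg_ex V).
    exact: (hilbertian_complete hV (fmap_proper_filter _ FF) c2).
  apply/cvg_ex; exists (a, b) => /=.
  move=> A /(cvg_pair Fa Fb) /=.
  by rewrite !nbhs_simpl /=; apply: (@filterS _ F) => -[].
Qed.

Lemma hilbertian_ip4 (R : realType) (V : normedModType R) (ip : V -> V -> R) :
  hilbertian ip -> hilbertian (V := (V * V * R * R)%type) (ip4 ip).
Proof.
by move=> hip; have hR := @hilbertian_mul R; do 3 apply: hilbertian_sum => //.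
Qed.

(** * Conjugates and the Fenchel-Moreau inequality *)

Section FenchelMoreau.
Context {R : realType} {V : normedModType R} {ip : V -> V -> R}.
Hypothesis hip : hilbertian ip.
Variable f : V -> \bar R.
Local Notation "f ^*" := (conjugate ip f).

Lemma ereal_le_fin (y : \bar R) (c : R) : (-oo < y)%E -> (y <= c%:E)%E ->
  exists2 r : R, y = r%:E & r <= c.
Proof. by case: y => // r _; rewrite lee_fin; exists r. Qed.

(** Real upper bounds [a] of [f x] keep extended arithmetic out of the later arguments: a point
    where [f] is infinite has no such bound and contributes only [-oo] to the supremum. *)
Lemma conjugate_leP (u : V) (c : R) : (forall x, -oo < f x)%E ->
  ((f^* u <= c%:E)%E <->
   forall x a, (f x <= a%:E)%E -> ip x u - a <= c).
Proof.
move=> f_gt; split=> [fu x a fxa|fu].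
  have [r fx ra] := ereal_le_fin (f_gt x) fxa.
  have : ((ip x u)%:E - f x <= c%:E)%E.
    by apply: le_trans fu; apply: ereal_sup_ubound; exists x.
  by rewrite fx lee_fin; lra.
apply/ereal_supP => _ [x _ <-]; have := f_gt x; have := fu x.
case: (f x) => [r h _|_ _|//].
  by rewrite lee_fin; exact: h.
by rewrite /= leNye.
Qed.

Lemma conjugate_gtNy (u : V) : Defs.proper f -> (-oo < f^* u)%E.
Proof.
move=> [f_gt [x xf]]; apply: (@lt_le_trans _ _ ((ip x u)%:E - f x)%E).
  move: xf (f_gt x); rewrite /Defs.dom /=.
  by case: (f x) => // r _ _; rewrite ltNyr.
by apply: ereal_sup_ubound; exists x.
Qed.

Definition epigraph : set (V * R) := [set z | (f z.1 <= z.2%:E)%E].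

Lemma epigraph_closed : lower_semicontinuous f -> closed epigraph.
Proof.
move=> lsc; rewrite -[epigraph]setCK; apply: open_closedC.
rewrite openE => -[x a] /= /negP; rewrite -ltNge /= => afx.
(* With [b] strictly between [a] and [f x], lower semicontinuity gives a neighbourhood [A] of [x]
   such that [A] times the half-line below [b] misses the epigraph. *)
have [b ab bfx] : exists2 b, a < b & (b%:E < f x)%E.
  case: (f x) afx => [r||//] ; rewrite ?lte_fin /= => ar.
    by exists ((a + r) / 2); rewrite ?lte_fin; lra.
  by exists (a + 1); rewrite ?ltry//; lra.
have [A Ax Ab] := lsc x b bfx.
exists (A, [set c | c < b]) => /=.
  by split => //; exact: lt_nbhsl.
move=> [y c] /= [Ay cb]; apply/negP; rewrite -ltNge.
by apply: le_lt_trans (Ab y Ay); rewrite lee_fin ltW.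
Qed.

Lemma epigraph_segment_closed : (forall x, -oo < f x)%E -> econvex f ->
  segment_closed (V := (V * R)%type) epigraph.
Proof.
move=> f_gt cf z w t /andP[t0 t1]; rewrite /epigraph /= => fz fw.
have [->|t_neq0] := eqVneq t 0.
  by rewrite subr0 !scale0r !add0r !scale1r.
have [->|t_neq1] := eqVneq t 1.
  by rewrite subrr !scale0r !addr0 !scale1r.
have t01 : 0 < t < 1 by rewrite !lt_neqAle t0 t1 eq_sym t_neq0 t_neq1.
have [r fzr rz] := ereal_le_fin (f_gt _) fz.
have [s fws sw] := ereal_le_fin (f_gt _) fw.
apply: le_trans (cf z.1 w.1 t t01) _; rewrite fzr fws lee_fin /=.
by apply: lerD; apply: ler_wpM2l => //; rewrite subr_ge0.
Qed.

Hypothesis hf : Gamma0 f.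

(** The pair [(p, pi)] is the projection of [(x, xi)] onto the epigraph, and the inequality is its
    variational characterization. *)
Lemma epigraph_separation (x : V) (xi : R) : (xi%:E < f x)%E ->
  exists p (pi : R), [/\ (f p <= pi%:E)%E, xi <= pi &
    forall y a, (f y <= a%:E)%E -> ip (y - p) (x - p) <= (a - pi) * (pi - xi)].
Proof.
have [[f_gt [x0 fx0]] lsc cf] := hf => xif.
have hsum := hilbertian_sum hip (@hilbertian_mul R).
have clE := epigraph_closed lsc.
have segE := epigraph_segment_closed f_gt cf.
have E0 : epigraph !=set0.
  have := f_gt x0; move: fx0; rewrite /Defs.dom /=.
  case fx0r: (f x0) => [r| |]// _ _.
  by exists (x0, r); rewrite /epigraph /= fx0r.
have [[p pi] P] := projection_exists hsum (x, xi) E0 clE segE.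
have sep y a : (f y <= a%:E)%E -> ip (y - p) (x - p) <= (a - pi) * (pi - xi).
  move=> fya; have := projection_variational hsum segE P (q := (y, a)) fya.
  by rewrite /sum_ip /= (ip_sym hip (x - p)); lra.
case: P => fp _; rewrite /epigraph /= in fp.
exists p, pi; split => //.
(* The epigraph is stable upwards: testing with the point one unit above the foot gives
   [xi <= pi]. *)
have fp1 : (f p <= (pi + 1)%:E)%E.
  by apply: le_trans fp _; rewrite lee_fin; lra.
by have := sep p (pi + 1) fp1; rewrite subrr -(scale0r 0) (ipZl hip); lra.
Qed.

(** The hyperplane is not vertical, so dividing by [pi - xi] gives the affine minorant
    [pi + ip (y - p) u] of [f]. At [x] its value is at least [pi], hence above [xi]. *)
Lemma steep_affine_minorant (x p : V) (xi pi : R) : xi < pi ->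
  (forall y a, (f y <= a%:E)%E ->
     ip (y - p) (x - p) <= (a - pi) * (pi - xi)) ->
  exists u b, (f^* u <= b%:E)%E /\ xi < ip x u - b.
Proof.
have [[f_gt _] _ _] := hf => xipi sep.
have d_gt0 : 0 < pi - xi by lra.
set d := pi - xi in d_gt0 sep *.
exists (d^-1 *: (x - p)), (ip p (d^-1 *: (x - p)) - pi); split.
  apply/conjugate_leP => // y a /sep h.
  have : ip (y - p) (d^-1 *: (x - p)) <= a - pi.
    by rewrite (ipZr hip) mulrC ler_pdivrMr.
  by rewrite (ipDl hip) (ipNl hip); lra.
have : 0 <= ip (x - p) (d^-1 *: (x - p)).
  by rewrite (ipZr hip) mulr_ge0 ?(ip_ge0 hip)// invr_ge0 ltW.
by rewrite (ipDl hip) (ipNl hip); lra.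
Qed.

(** Separating a point just below the graph, over an [x] in the domain, cannot produce a vertical
    hyperplane. *)
Lemma conjugate_dom : exists u b, (f^* u <= b%:E)%E.
Proof.
have [[f_gt [x fx_lt]] _ _] := hf; rewrite /Defs.dom /= in fx_lt.
have [r fx] : exists r, f x = r%:E.
  by move: (f_gt x) fx_lt; case: (f x) => // r; exists r.
have [|p [pi [fp xipi sep]]] := @epigraph_separation x (r - 1).
  by rewrite fx lte_fin; lra.
suff /steep_affine_minorant/(_ sep)[u [b []]] : r - 1 < pi by exists u, b.
(* In the vertical case, testing with [(x, r)] forces [p = x], whence [r <= r - 1]. *)
rewrite lt_neqAle xipi andbT; apply/eqP => rpi.
have /subr0_eq xp : x - p = 0.
  apply: (ip_eq0 hip); have := sep x r.
  by rewrite fx => /(_ (lexx _)); rewrite -rpi subrr mulr0.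
by move: fp; rewrite -xp fx lee_fin; lra.
Qed.

(* If the separating hyperplane of the epigraph is vertical, a large multiple
   of its normal is added to an arbitrary element of the domain of f^*. *)
Lemma affine_minorant_above (x : V) (xi : R) : (xi%:E < f x)%E ->
  exists u b, (f^* u <= b%:E)%E /\ xi < ip x u - b.
Proof.
have [[f_gt _] _ _] := hf => xifx.
have [p [pi [fp xipi sep]]] := epigraph_separation xifx.
have [xi_lt|xi_ge] := ltP xi pi; first exact: steep_affine_minorant sep.
have {xipi xi_ge} ? : pi = xi by apply/eqP; rewrite eq_le xipi xi_ge.
subst pi; have {sep} vert y a : (f y <= a%:E)%E -> ip (y - p) (x - p) <= 0.
  by move=> /sep; rewrite subrr mulr0.
have w_gt0 : 0 < ip (x - p) (x - p).
  rewrite lt_neqAle (ip_ge0 hip) andbT eq_sym; apply/eqP => w0.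
  have /subr0_eq xp : x - p = 0 by apply: (ip_eq0 hip); rewrite w0.
  by move: fp; rewrite leNgt -xp xifx.
have [u [b fu]] := conjugate_dom.
set w := x - p in vert w_gt0.
(* By [vert], adding [t *: w] to the slope costs at most [t * ip p w] on the domain. At [x] it gains
   [t * ip w w], which this choice makes larger than the deficit [xi - (ip x u - b)]. *)
pose t := (`|xi - (ip x u - b)| + 1) / ip w w.
have t_ge0 : 0 <= t by rewrite divr_ge0 ?(ltW w_gt0)// addr_ge0.
exists (u + t *: w), (b + t * ip p w); split.
  apply/conjugate_leP => // y a fya.
  have := (conjugate_leP u b f_gt).1 fu y a fya.
  have := vert y a fya.
  rewrite (ipDl hip) (ipNl hip) (ipDr hip) (ipZr hip); nra.
have : t * ip w w = `|xi - (ip x u - b)| + 1 by rewrite divfK// gt_eqF.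
have := ler_norm (xi - (ip x u - b)).
rewrite (ipDr hip) (ipZr hip) {1}/w (ipDl hip) (ipNl hip); lra.
Qed.

(** This is the inequality between [f] and its biconjugate, expressed through real upper bounds. *)
Lemma biconjugate_le (x : V) (xi : R) :
  (forall u b, (f^* u <= b%:E)%E -> ip x u - b <= xi) -> (f x <= xi%:E)%E.
Proof.
move=> h; rewrite leNgt; apply/negP => /affine_minorant_above[u [b [fu]]].
by rewrite ltNge h.
Qed.

End FenchelMoreau.

(** * Polar cones and the Moreau decomposition *)

Section Polar.
Context {R : realType} {V : normedModType R} {ip : V -> V -> R}.
Hypothesis hip : hilbertian ip.
Implicit Types (C Q : set V).

Definition polar (ip : V -> V -> R) Q : set V :=
  [set z | forall q, Q q -> ip z q <= 0].

Lemma polar_neq0 Q : polar ip Q !=set0.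
Proof. by exists 0 => q _; rewrite -(scale0r 0) (ipZl hip) mul0r. Qed.

Lemma polar_cone Q : is_cone (polar ip Q).
Proof.
by move=> t x t_gt0 Kx q Qq; rewrite (ipZl hip) pmulr_rle0// Kx.
Qed.

Lemma polar_segment_closed Q : segment_closed (polar ip Q).
Proof.
move=> x y t /andP[t0 t1] Kx Ky q Qq; rewrite (ipDl hip) !(ipZl hip).
have := Kx q Qq; have := Ky q Qq; nra.
Qed.

Lemma polar_closed Q : closed (polar ip Q).
Proof.
have -> : polar ip Q = \bigcap_(q in Q) [set z | ip z q <= 0] by [].
apply: closed_bigI => q _.
have /continuous_closedP h := @continuous_ipl _ _ _ hip q.
by have := h _ (@closed_le R 0).
Qed.

Lemma segment_closed_convex_set C : segment_closed C -> convex_set C.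
Proof.
move=> cC x y t; rewrite !inE => Cx Cy.
by apply: cC => //; apply/andP; split; [exact: ge0|exact: le1].
Qed.

(** Once both cones are written as polars, this yields all the properties claimed for them. *)
Lemma polarP Q : [/\ polar ip Q !=set0, closed (polar ip Q),
  convex_set (polar ip Q) & is_cone (polar ip Q)].
Proof.
split; [exact: polar_neq0|exact: polar_closed| |exact: polar_cone].
exact/segment_closed_convex_set/polar_segment_closed.
Qed.

(* p - L (s - p) is shown to have norm 0: its squared norm expands into the two
   pairings ip z (L z), at z = p and z = L (s - p), which are nonpositive. *)
Lemma moreau_swap C (L : V -> V) s p :
  is_cone C -> segment_closed C -> involutive L -> {morph L : x y / x - y} ->
  (forall x y, ip (L x) (L y) = ip x y) ->
  (forall x, C x -> ip x (L x) <= 0) ->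
  polar ip C `<=` L @^-1` C ->
  L s = s -> is_projection ip C s p -> s - p = L p /\ ip p (L p) = 0.
Proof.
move=> coneC cC LK LB Liso pair dualC Ls P; have Cp := P.1.
have var q Cq := projection_variational hip cC P (q := q) Cq.
(* Testing the variational inequality with [2 *: p] and [2^-1 *: p], both in the cone, gives the two
   signs. *)
have orth : ip (s - p) p = 0.
  apply/eqP; rewrite eq_le; apply/andP; split.
    have /var : C (2 *: p) by apply: coneC.
    by rewrite (ipDr hip) (ipNr hip) (ipZr hip); lra.
  have /var : C (2^-1 *: p) by apply: coneC; rewrite // invr_gt0.
  by rewrite (ipDr hip) (ipNr hip) (ipZr hip); lra.
have CLn : C (L (s - p)).
  by apply: dualC => q /var; rewrite (ipDr hip) (ipNr hip) orth subr0.
have pair1 := pair _ Cp; have pair2 := pair _ CLn; rewrite LK in pair2.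
(* Since [L s = s], one factor of the squared norm of [p - L (s - p)] can be replaced by
   [L p - (s - p)]. Of the four resulting terms, two are the pairings and two vanish by [orth]. *)
have e : s - p - L p = - (p - L (s - p)).
  by rewrite LB Ls !opprB; rewrite addrAC.
have d0 : p - L (s - p) = 0.
  apply: (ip_eq0 hip); rewrite -{2}[p - _]opprK -e.
  have : ip (L (s - p)) (L p) = 0 by rewrite Liso.
  move: orth pair1 pair2; rewrite (ip_sym hip (s - p) p).
  move: (s - p) (L (s - p)) (L p) => n Ln Lp.
  by rewrite !(ipDl hip, ipNl hip, ipDr hip, ipNr hip); lra.
have sp : s - p = L p by apply/eqP; rewrite -subr_eq0 e d0 oppr0.
by split=> //; rewrite -sp (ip_sym hip).
Qed.

End Polar.

(** * The cone of F is exchanged with its polar *)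

Section SelfDualCone.
Context {R : realType} {V : normedModType R} {ip : V -> V -> R}.
Hypothesis hip : hilbertian ip.
Variable f : V -> \bar R.
Hypothesis hf : Gamma0 f.
Local Notation "f ^*" := (conjugate ip f).

Let F (z : V * V) : \bar R := (f z.1 + f^* z.2)%E.

Let eq_lee (y z : \bar R) : y = z -> (y <= z)%E.
Proof. by move->. Qed.

Let f_gt x : (-oo < f x)%E.
Proof. by case: hf => -[]. Qed.

Let fs_gt u : (-oo < f^* u)%E.
Proof. by apply: conjugate_gtNy; case: hf. Qed.

Lemma separable_sum_fin z (c : R) : (F z <= c%:E)%E ->
  exists r s : R, [/\ f z.1 = r%:E, f^* z.2 = s%:E & r + s <= c].
Proof.
rewrite /F; move: (f_gt z.1) (fs_gt z.2).
case: (f z.1) => // [r|]; case: (f^* z.2) => // s _ _.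
by rewrite lee_fin; exists r, s.
Qed.

Lemma fenchel_young (x u : V) (a b : R) : (f x <= a%:E)%E ->
  (f^* u <= b%:E)%E -> ip x u <= a + b.
Proof. by move=> fx /(conjugate_leP _ _ f_gt)/(_ x a fx); lra. Qed.

(* F coincides with its own conjugate composed with the swap of the two
   variables. *)
Lemma separable_sum_leP z (c : R) : (F z <= c%:E)%E <->
  forall a b al be, (f a <= al%:E)%E -> (f^* b <= be%:E)%E ->
    (ip a z.2 - al) + (ip z.1 b - be) <= c.
Proof.
split=> [/separable_sum_fin[r [s [fr fs rs]]] a b al be fa fb|h].
  have := fenchel_young (x := z.1) (a := r) (eq_lee fr) fb.
  have := fenchel_young fa (eq_lee fs).
  lra.
(* Any point of the domain of the conjugate first shows that the conjugate is finite at [z.2]. With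
   that value [s] fixed, biconjugation bounds [f z.1] by [c - s]. *)
have [b0 [be0 fb0]] := conjugate_dom hip hf.
have fsz : (f^* z.2 <= (c - (ip z.1 b0 - be0))%:E)%E.
  by apply/conjugate_leP => // a al fa; have := h _ _ _ _ fa fb0; lra.
have [s fs _] := ereal_le_fin (fs_gt _) fsz.
have fz : (f z.1 <= (c - s)%:E)%E.
  apply: (biconjugate_le hip hf) => b be fb.
  have : (f^* z.2 <= (c - (ip z.1 b - be))%:E)%E.
    by apply/conjugate_leP => // a al fa; have := h _ _ _ _ fa fb; lra.
  by rewrite fs lee_fin; lra.
have [r fr rs] := ereal_le_fin (f_gt _) fz.
by rewrite /F fr fs lee_fin; lra.
Qed.

Lemma recession_shift (w z : V * V) (c d : R) : (recession F w <= d%:E)%E ->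
  (F z <= c%:E)%E -> (F (z + w)%R <= (c + d)%:E)%E.
Proof.
move=> rw Fz; have [r [s [fr fs rs]]] := separable_sum_fin Fz.
have Fzrs : F z = (r + s)%:E by rewrite /F fr fs.
have : (F (z + w)%R - F z <= d%:E)%E.
  apply: le_trans rw; apply: ereal_sup_ubound; exists z => //.
  by rewrite /Defs.dom /= Fzrs ltry.
rewrite Fzrs leeBlDr// => h; apply: le_trans h _.
by rewrite lee_fin; lra.
Qed.

Lemma recession_shiftn (w z : V * V) (c d : R) n : (recession F w <= d%:E)%E ->
  (F z <= c%:E)%E -> (F (z + n%:R *: w)%R <= (c + n%:R * d)%:E)%E.
Proof.
move=> rw Fz; elim: n => [|n IH]; first by rewrite mulr0n scale0r mul0r !addr0.
have := recession_shift rw IH.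
by rewrite -natr1 scalerDl scale1r mulrDl mul1r !addrA.
Qed.

Lemma multiples_bounded_le0 (a c : R) : (forall n, n%:R * a <= c) -> a <= 0.
Proof.
move=> h; rewrite leNgt; apply/negP => a_gt0.
have := h (Num.bound `|c / a|); rewrite -ler_pdivlMr// leNgt.
by rewrite (le_lt_trans (ler_norm _))// archi_boundP.
Qed.

(** The recession function is the support function of the domain of the conjugate of [F], here the
    domain of [F] with its variables exchanged. The bounds [al] and [be] only witness finiteness. *)
Lemma recession_leP (w : V * V) (d : R) : (recession F w <= d%:E)%E <->
  forall a b al be, (f a <= al%:E)%E -> (f^* b <= be%:E)%E ->
    ip a w.2 + ip w.1 b <= d.
Proof.
split=> [rw a b al be fa fb|h].
  have Fab : (F (a, b) <= (al + be)%:E)%E by rewrite EFinD /F leeD.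
  (* Along the ray from [(a, b)] in direction [w], the bound on [F] grows by [d] per step. Comparing
     it with the affine minorant given by [(a, b)] bounds all multiples of the difference. *)
  rewrite -subr_le0; apply: (@multiples_bounded_le0 _ (2 * (al + be - ip a b))).
  move=> n; have := recession_shiftn n rw Fab.
  move=> /separable_sum_leP/(_ _ _ _ _ fa fb) /=.
  by rewrite (ipDr hip) (ipDl hip) (ipZr hip) (ipZl hip); lra.
apply/ereal_supP => _ [z zdom <-].
have [r [s [fr fs _]]] : exists r s, [/\ f z.1 = r%:E, f^* z.2 = s%:E & True].
  move: zdom; rewrite /Defs.dom /= => zdom.
  have [c Fz] : exists c, F z = c%:E.
    move: zdom (f_gt z.1) (fs_gt z.2); rewrite /F.
    case: (f z.1) => [r||]//; case: (f^* _) => [s||]//= _ _ _.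
    by exists (r + s).
  have := @separable_sum_fin z c; rewrite Fz => /(_ (lexx _)).
  by move=> [r [s [? ? _]]]; exists r, s.
have Fz : F z = (r + s)%:E by rewrite /F fr fs.
rewrite Fz leeBlDr//; apply/separable_sum_leP => a b al be fa fb /=.
have := h _ _ _ _ fa fb.
have := fenchel_young (x := z.1) (a := r) (eq_lee fr) fb.
have := fenchel_young fa (eq_lee fs).
by rewrite (ipDr hip) (ipDl hip); lra.
Qed.

Definition primal_dual_cone : set (V * V * R * R) :=
  [set z | (perspective F z.1 <= (- z.2)%:E)%E].

(** One family of linear inequalities covers both cases: for positive [tau] it is
    [separable_sum_leP] at the rescaled point, multiplied by [tau]; for [tau = 0] it is
    [recession_leP]. *)
Lemma primal_dual_coneP z : primal_dual_cone z <-> 0 <= z.1.2 /\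
  forall a b al be, (f a <= al%:E)%E -> (f^* b <= be%:E)%E ->
    ip a z.1.1.2 + ip z.1.1.1 b + z.2 <= z.1.2 * (al + be).
Proof.
case: z => [[[x nu] tau] kappa]; rewrite /primal_dual_cone /perspective /=.
have [tau_gt0|tau_lt0|<-] := ltgtP 0 tau.
- have -> : (tau%:E * F (tau^-1 *: (x, nu)) <= (- kappa)%:E)%E =
            (F (tau^-1 *: (x, nu)) <= (tau^-1 * - kappa)%:E)%E.
    by rewrite EFinM lee_pdivlMl.
  rewrite separable_sum_leP /=; split=> [h|[_ h] a b al be fa fb].
    split=> // a b al be fa fb; have := h _ _ _ _ fa fb.
    rewrite (ipZr hip) (ipZl hip) -(ler_pM2l tau_gt0).
    rewrite mulVKf ?gt_eqF// !mulrDr !mulVKf ?gt_eqF//; lra.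
  rewrite (ipZr hip) (ipZl hip) -(ler_pM2l tau_gt0).
  rewrite mulVKf ?gt_eqF// !mulrDr !mulVKf ?gt_eqF//.
  by have := h _ _ _ _ fa fb; lra.
- by split=> // -[].
- rewrite recession_leP /=; split=> [h|[_ h] a b al be fa fb].
    by split=> // a b al be fa fb; have := h _ _ _ _ fa fb; lra.
  by have := h _ _ _ _ fa fb; lra.
Qed.

(** For positive [tau] this is the Fenchel-Young inequality at the point rescaled by [tau]. For
    [tau = 0] it follows from the behaviour of the recession bound along a ray. *)
Lemma primal_dual_cone_pairing_le0 z :
  primal_dual_cone z -> ip z.1.1.1 z.1.1.2 + z.1.2 * z.2 <= 0.
Proof.
case: z => [[[x nu] tau] kappa]; rewrite /primal_dual_cone /perspective /=.
have [tau_gt0|//|<-] := ltgtP 0 tau.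
  rewrite -lee_pdivlMl//= -EFinM => /separable_sum_fin /= [r [s [fr fs rs]]].
  have := fenchel_young (eq_lee fr) (eq_lee fs).
  rewrite (ipZr hip) (ipZl hip).
  move=> /le_trans /(_ rs).
  by rewrite !ler_pdivrMl// mulVKf ?gt_eqF//; lra.
move=> rw; have [u [b fu]] := conjugate_dom hip hf.
have [[_ [x0 x0f]] _ _] := hf.
have [r fx0] : exists r, f x0 = r%:E.
  by move: (f_gt x0) x0f; rewrite /Defs.dom /=; case: (f x0) => // r; exists r.
have F0 : (F (x0, u) <= (r + b)%:E)%E by rewrite EFinD /F /= fx0 leeD.
rewrite mul0r addr0.
suff : 2 * ip x nu <= 0 by lra.
(* The points [(x0, u) + n (x, nu)] stay in the domain of [F]; inserted into [recession_leP], they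
   give a term linear in [n] with coefficient [2 * ip x nu]. *)
apply: (@multiples_bounded_le0 _ (- kappa - (ip x0 nu + ip x u))) => n.
have [al [be [fa fb _]]] := separable_sum_fin (recession_shiftn n rw F0).
have := (recession_leP _ _).1 rw _ _ _ _ (eq_lee fa) (eq_lee fb).
by rewrite /= (ipDr hip) (ipDl hip) (ipZr hip) (ipZl hip); lra.
Qed.

(* The vectors (0,0,-1,0) and (b,a,-(al+be),1) come from the exchange applied to
   the elements (0,0,0,-1) and (a,b,1,-(al+be)) of the cone. *)
Definition cone_normals : set (V * V * R * R) :=
  [set (0, 0, -1, 0)] `|` [set q | exists a b al be,
    [/\ (f a <= al%:E)%E, (f^* b <= be%:E)%E & q = (b, a, - (al + be), 1)]].

Lemma primal_dual_cone_generator (a b : V) (al be : R) : (f a <= al%:E)%E ->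
  (f^* b <= be%:E)%E -> primal_dual_cone (a, b, 1, - (al + be)).
Proof.
move=> fa fb; rewrite /primal_dual_cone /perspective /= ltr01 invr1.
by rewrite scale1r mul1e opprK /F EFinD leeD.
Qed.

Lemma primal_dual_cone_vertical : primal_dual_cone (0, 0, 0, -1).
Proof.
apply/primal_dual_coneP; split=> //= a b al be _ _.
by rewrite -(scale0r 0) (ipZr hip) (ipZl hip); lra.
Qed.

(** Testing against the vertical element gives [0 <= rho]; testing against the generators gives the
    inequalities of [primal_dual_coneP] for the exchanged vector. *)
Lemma polar_primal_dual_cone u w eta rho :
  (forall q, primal_dual_cone q -> ip4 ip (u, w, eta, rho) q <= 0) ->
  primal_dual_cone (w, u, rho, eta).
Proof.
move=> polar; apply/primal_dual_coneP; split=> /=.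
  have := polar _ primal_dual_cone_vertical; rewrite /ip4 /sum_ip /=.
  by rewrite -(scale0r 0) !(ipZr hip); lra.
move=> a b al be fa fb; have := polar _ (primal_dual_cone_generator fa fb).
by rewrite /ip4 /sum_ip /= (ip_sym hip u); lra.
Qed.

(** The inequalities of [primal_dual_coneP] are pairings with [cone_normals], the vector
    [(0, 0, -1, 0)] encoding the sign of [tau]. Closedness and convexity then need no direct study
    of the perspective. *)
Lemma primal_dual_cone_polar : primal_dual_cone = polar (ip4 ip) cone_normals.
Proof.
apply/seteqP; split=> -[[[x nu] tau] kappa].
  move=> /primal_dual_coneP[/= tau_ge0 h] _ [->|[a [b [al [be [fa fb ->]]]]]].
    by rewrite /ip4 /sum_ip /= -(scale0r 0) !(ipZr hip); lra.
  by have := h _ _ _ _ fa fb; rewrite /ip4 /sum_ip /= (ip_sym hip nu); lra.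
move=> h; apply/primal_dual_coneP; split=> /=.
  have := h _ (or_introl erefl).
  by rewrite /ip4 /sum_ip /= -(scale0r 0) !(ipZr hip); lra.
move=> a b al be fa fb.
have : cone_normals (b, a, - (al + be), 1) by right; exists a, b, al, be.
by move=> /h; rewrite /ip4 /sum_ip /= (ip_sym hip nu); lra.
Qed.

Lemma primal_dual_cone_projection p r x nu tau kappa :
  is_projection (ip4 ip) primal_dual_cone (p, p, r, r) (x, nu, tau, kappa) ->
  [/\ nu = p - x, kappa = r - tau & ip x (p - x) + tau * (r - tau) = 0].
Proof.
move=> P; have hip4 := hilbertian_ip4 hip.
pose L (z : V * V * R * R) := (z.1.1.2, z.1.1.1, z.2, z.1.2).
have coneC : is_cone primal_dual_cone.
  by rewrite primal_dual_cone_polar; exact: polar_cone.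
have cC : segment_closed primal_dual_cone.
  by rewrite primal_dual_cone_polar; exact: polar_segment_closed.
have LK : involutive L by case=> [[[? ?] ?] ?].
have LB : {morph L : z w / z - w} by case=> [[[? ?] ?] ?] [[[? ?] ?] ?].
have Liso z w : ip4 ip (L z) (L w) = ip4 ip z w.
  by rewrite /ip4 /sum_ip /=; lra.
have pair z : primal_dual_cone z -> ip4 ip z (L z) <= 0.
  move=> /primal_dual_cone_pairing_le0; rewrite /ip4 /sum_ip /=.
  by rewrite (ip_sym hip z.1.1.2); lra.
have dualC : polar (ip4 ip) primal_dual_cone `<=` L @^-1` primal_dual_cone.
  by case=> [[[u w] eta] rho] h; exact: polar_primal_dual_cone.
have [e o] := moreau_swap hip4 coneC cC LK LB Liso pair dualC erefl P.
(* The orthogonality relation contains each product twice, so it is twice the desired identity. *)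
case: e => ? e1 ? e2; move: o; rewrite /ip4 /sum_ip /= (ip_sym hip nu) => o.
have nuE : nu = p - x by [].
have kappaE : kappa = r - tau by [].
by split=> //; rewrite -nuE -kappaE; lra.
Qed.

End SelfDualCone.

(** * The sign change carrying the cone of G to one of the first kind *)

Section Flip.
Context {R : realType} {V : normedModType R} {ip : V -> V -> R}.
Hypothesis hip : hilbertian ip.

Definition flip4 (z : V * V * R * R) : V * V * R * R :=
  (z.1.1.1, - z.1.1.2, z.1.2, - z.2).

Lemma flip4K : involutive flip4.
Proof. by case=> [[[? ?] ?] ?]; rewrite /flip4 /= !opprK. Qed.

Lemma flip4B : {morph flip4 : z w / z - w}.
Proof.
case=> [[[x nu] tau] kappa] [[[y mu] s] t]; rewrite /flip4 /=.
by congr (_, _, _, _); exact: opprD.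
Qed.

Lemma ip4_flip z w : ip4 ip (flip4 z) w = ip4 ip z (flip4 w).
Proof. by rewrite /ip4 /sum_ip /= (ipNl hip) (ipNr hip); lra. Qed.

Lemma flip4_polar (Q : set (V * V * R * R)) :
  flip4 @^-1` polar (ip4 ip) Q = polar (ip4 ip) (flip4 @` Q).
Proof.
apply/seteqP; split=> z h.
  by move=> _ [q Qq <-]; rewrite -ip4_flip; exact: h.
by move=> q Qq; rewrite ip4_flip; apply: h; exists q.
Qed.

(** Being self-adjoint and involutive, [flip4] is an isometry, so it transports nearest points. *)
Lemma is_projection_flip4 (C : set (V * V * R * R)) z w :
  is_projection (ip4 ip) (flip4 @^-1` C) z w ->
  is_projection (ip4 ip) C (flip4 z) (flip4 w).
Proof.
move=> [Cw minw]; split=> // q Cq.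
have nf v : ip_norm (ip4 ip) (flip4 v) = ip_norm (ip4 ip) v.
  by rewrite /ip_norm ip4_flip flip4K.
rewrite -(flip4K q) -!flip4B !nf; apply: minw.
by rewrite /preimage /= flip4K.
Qed.

Lemma primal_dual_cone_flip4 (g : V -> \bar R) :
  [set z : V * V * R * R | (perspective
     (fun w : V * V => (g w.1 + conjugate ip g (- w.2)%R)%E) z.1
     <= z.2%:E)%E] = flip4 @^-1` primal_dual_cone (ip := ip) g.
Proof.
apply/funext => -[[[x nu] tau] kappa].
rewrite /primal_dual_cone /preimage /= opprK; congr (is_true (_ <= _)%E).
rewrite /perspective /=; case: ifP => [_|_]; first by rewrite scalerN.
(* For [tau = 0] the two suprema agree after reindexing the domain by the change of sign of [b]. *)
case: ifP => [_|//]; congr ereal_sup; apply/seteqP; split=> _ [[a b] dab <-].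
  by exists (a, - b); rewrite //= opprD.
by exists (a, - b); rewrite /Defs.dom /= ?opprK// opprD !opprK.
Qed.

End Flip.

(** * Symmetry of the Douglas-Rachford iterates *)

Theorem mainTheorem3 (R : realType) (H : completeNormedModType R)
    (ip : {dot H for idfun}) (ipE : induces_norm ip)
    (f g : H -> \bar R) (hf : Gamma0 f) (hg : Gamma0 g)
    (duality :
      ereal_inf [set (f x + g x)%E | x in [set: H]] =
      ereal_sup [set (- conjugate ip f nu - conjugate ip g (- nu)%R)%E
                | nu in [set: H]]) :
  let F := (fun z : H * H => (f z.1 + conjugate ip f z.2)%E) in
  let G := (fun z : H * H => (g z.1 + conjugate ip g (- z.2)%R)%E) in
  let coneF : set (H * H * R * R) :=
    [set z | (perspective F z.1 <= (- z.2)%:E)%E] in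
  let coneG : set (H * H * R * R) :=
    [set z | (perspective G z.1 <= z.2%:E)%E] in
  let PF := projection (ip4 ip) coneF in
  let PG := projection (ip4 ip) coneG in
  [/\ coneF !=set0, closed coneF, convex_set coneF & is_cone coneF] /\
  [/\ coneG !=set0, closed coneG, convex_set coneG & is_cone coneG] /\
  forall (sx snu : nat -> H) (stau skappa : nat -> R)
         (x nu : nat -> H) (tau kappa : nat -> R)
         (xt nut : nat -> H) (taut kappat : nat -> R)
         (p1 : H) (r1 : R),
    (forall k, (1 <= k)%N ->
      [/\ (x k, nu k, tau k, kappa k) =
            PF (sx k, snu k, stau k, skappa k),
          (xt k, nut k, taut k, kappat k) =
            PG ((2 : R) *: (x k, nu k, tau k, kappa k)
                - (sx k, snu k, stau k, skappa k))
        & (sx k.+1, snu k.+1, stau k.+1, skappa k.+1) =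
            (sx k, snu k, stau k, skappa k)
            + (xt k, nut k, taut k, kappat k)
            - (x k, nu k, tau k, kappa k)]) ->
    sx 1%N = p1 -> snu 1%N = p1 -> stau 1%N = r1 -> skappa 1%N = r1 ->
    let p := sx in
    let r := stau in
    let pt := fun k => (2 : R) *: x k - p k in
    let rt := fun k => 2 * tau k - r k in
    forall k, (1 <= k)%N ->
      (sx k = snu k /\ stau k = skappa k) /\
      [/\ (x k, nu k, tau k, kappa k) = PF (p k, p k, r k, r k),
          nu k = p k - x k & kappa k = r k - tau k] /\
      [/\ (xt k, nut k, taut k, kappat k) = PG (pt k, - pt k, rt k, - rt k),
          nut k = xt k - pt k & kappat k = taut k - rt k] /\
      (p k.+1, r k.+1) = (p k, r k) + (xt k, taut k) - (x k, tau k) /\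
      ip (x k) (p k - x k) + tau k * (r k - tau k) = 0 /\
      ip (xt k) (pt k - xt k) + taut k * (rt k - taut k) = 0.
Proof.
move=> F G coneF coneG PF PG.
have hip := hilbertian_dot ipE; have hip4 := hilbertian_ip4 hip.
have coneFE : coneF = primal_dual_cone (ip := ip) f by [].
have coneGE : coneG = flip4 @^-1` primal_dual_cone (ip := ip) g.
  exact: primal_dual_cone_flip4.
have coneFP : coneF = polar (ip4 ip) (cone_normals (ip := ip) f).
  by rewrite coneFE; exact: primal_dual_cone_polar.
have coneGP : coneG = polar (ip4 ip) (flip4 @` cone_normals (ip := ip) g).
  by rewrite coneGE primal_dual_cone_polar// flip4_polar.
(* A nearest point exists, so the default value of [projection] never occurs. *)
have PFP z : is_projection (ip4 ip) coneF z (PF z).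
  rewrite /PF coneFP; apply: (projectionP hip4).
  - exact: polar_neq0.
  - exact: polar_closed.
  - exact: polar_segment_closed.
have PGP z : is_projection (ip4 ip) coneG z (PG z).
  rewrite /PG coneGP; apply: (projectionP hip4).
  - exact: polar_neq0.
  - exact: polar_closed.
  - exact: polar_segment_closed.
split; first by rewrite coneFP; exact: polarP.
split; first by rewrite coneGP; exact: polarP.
move=> sx snu stau skappa x nu tau kappa xt nut taut kappat p1 r1 step.
move=> sx1 snu1 stau1 skappa1 p r pt rt.
(* One step of the iteration, under the assumption that its starting point is symmetric. *)
have iterate k : (1 <= k)%N -> sx k = snu k -> stau k = skappa k ->
    [/\ nu k = p k - x k, kappa k = r k - tau k &
        ip (x k) (p k - x k) + tau k * (r k - tau k) = 0] /\
    [/\ (xt k, nut k, taut k, kappat k) = PG (pt k, - pt k, rt k, - rt k),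
        nut k = xt k - pt k, kappat k = taut k - rt k &
        ip (xt k) (pt k - xt k) + taut k * (rt k - taut k) = 0].
  move=> k_ge1 esx estau; have [eF eG _] := step k k_ge1.
  rewrite -esx -estau in eF eG.
  have := PFP (sx k, sx k, stau k, stau k); rewrite -eF.
  move=> /(primal_dual_cone_projection hip hf)[nuE kappaE orth].
  split; first by [].
  (* The reflected point is antisymmetric: [nu k = p k - x k] gives [2 *: nu k - p k = - pt k], and
     likewise for [kappa k]. *)
  have {}eG : (xt k, nut k, taut k, kappat k) = PG (pt k, - pt k, rt k, - rt k).
    rewrite eG; congr PG; congr (_, _, _, _) => /=.
    - rewrite nuE /pt /p scalerBr !scaler_nat !mulr2n !opprD !opprK.
      by rewrite addrAC addrK addrC.
    - by rewrite -[2 *: kappa k]/(2 * kappa k) kappaE /rt /r; ring.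
  have := PGP (pt k, - pt k, rt k, - rt k); rewrite -eG coneGE.
  (* The flip makes this point symmetric, so the projection lemma applies with [g], to [- nut k] and
     [- kappat k]. *)
  move=> /(is_projection_flip4 hip); rewrite /flip4 /= !opprK.
  move=> /(primal_dual_cone_projection hip hg)[nutE kappatE ortht].
  by split=> //; apply: oppr_inj; rewrite opprB.
have eqs k : (1 <= k)%N -> sx k = snu k /\ stau k = skappa k.
  elim: k => // -[_ _|k IH _]; first by rewrite sx1 snu1 stau1 skappa1.
  have [esx estau] := IH isT.
  have [[nuE kappaE _] [_ nutE kappatE _]] := iterate k.+1 isT esx estau.
  have [_ _ [-> -> -> ->]] := step k.+1 isT.
  (* Symmetry persists because both components receive the same increment:
     [nut - nu = (xt - pt) - (p - x)] equals [xt - x], as [pt] is [2 *: x - p]. *)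
  rewrite -esx -estau nuE nutE kappaE kappatE /pt /rt /p /r; split; last by ring.
  move: (sx k.+1) (xt k.+1) (x k.+1) => s t y.
  rewrite !opprB [RHS]addrC subrKA scaler_nat mulr2n opprD.
  by rewrite [RHS]addrC !addrA subrK [t + s]addrC.
move=> k k_ge1; have [esx estau] := eqs k k_ge1.
have [[nuE kappaE orth] [eG nutE kappatE ortht]] := iterate k k_ge1 esx estau.
have [eF _ estep] := step k k_ge1.
rewrite -esx -estau in eF estep; case: estep => ? _ ? _.
by do !split => //; congr (_, _).
Qed.
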